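(* Let $\sigma$ be a finite relational signature without constant symbols and $n$ a positive integer. The Eilenberg--Moore category $\mathrm{EM}(\mathbb{P}_n)$ of coalgebras for the pebbling comonad $\mathbb{P}_n$ on $\mathbf{Struct}(\sigma)$ is isomorphic to the full subcategory of the category $\mathcal{R}^{(n)}(\sigma)$ of $n$-pebble forest-ordered structures consisting of those $(A,\le,p)$ that satisfy conditions (E) and (P) below.
   Context: $\mathbb{P}_n(A)$ has universe the non-empty finite sequences of elements of $\mathbf{n}\times A$ ($\mathbf{n}=\{1,\dots,n\}$); a $j$-ary $R$ holds of $(s_1,\dots,s_j)$ iff the $s_i$ are pairwise prefix-comparable, whenever $s_i$ is a prefix of $s_{i'}$ the pebble index of the last move of $s_i$ does not occur in the remainder of $s_{i'}$, and the last elements of the $s_i$ form a tuple in $R^A$. Its counit takes the last element; its comultiplication sends $s$ to the sequence of pairs (pebble index of the $i$-th move, $i$-th prefix of $s$); it acts on homomorphisms pointwise on the $A$-components. A coalgebra for a comonad $(G,\epsilon,\delta)$ is $(A,\alpha\colon A\to GA)$ with $\delta_A\circ\alpha=G\alpha\circ\alpha$, $\epsilon_A\circ\alpha=\mathrm{id}_A$; morphisms commute with the structure maps. A forest is a poset in which every down-set $\{x'\mid x'\le x\}$ is finite and linearly ordered; a forest morphism is a monotone map preserving height, where the height of $x$ is $|\{x'\le x\}|-1$. Objects of $\mathcal{R}^{(n)}(\sigma)$ are triples $(A,\le,p)$ with $A$ a $\sigma$-structure, $\le$ a forest order on $A$ and $p\colon A\to\mathbf{n}$; morphisms are homomorphisms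 that are forest morphisms and preserve $p$. The Gaifman graph of $A$ has vertices the elements of $A$, with distinct $a,b$ adjacent iff they occur together in some tuple of some relation of $A$. (E): adjacent elements of the Gaifman graph are $\le$-comparable. (P): if $a,b$ are adjacent in the Gaifman graph and $a<b$, then $p(a)\ne p(x)$ for all $x$ with $a<x\le b$. *)

(* Defs.v *)
From mathcomp Require Import all_boot.
From mathcomp Require Import boolp classical_sets cardinality.
From Stdlib Require Relation_Definitions.

Set Implicit Arguments.
Unset Strict Implicit.
Unset Printing Implicit Defensive.

#[local] Obligation Tactic := idtac.

(* Homs are compared with Leibniz equality. *)
Record category := Category {
  ob :> Type;
  hom : ob -> ob -> Type;
  idm : forall X, hom X X;
  comp : forall X Y Z, hom Y Z -> hom X Y -> hom X Z;
  comp1m : forall X Y (f : hom X Y), comp (idm Y) f = f;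
  compm1 : forall X Y (f : hom X Y), comp f (idm X) = f;
  compmA : forall X Y Z W (f : hom X Y) (g : hom Y Z) (h : hom Z W),
    comp h (comp g f) = comp (comp h g) f }.

Arguments idm {c} X.
Arguments comp {c X Y Z} g f.

Record functor (C D : category) := Functor {
  fob :> C -> D;
  fmap : forall X Y, hom X Y -> hom (fob X) (fob Y);
  fmap1 : forall X, fmap (idm X) = idm (fob X);
  fmapM : forall X Y Z (g : hom Y Z) (f : hom X Y),
    fmap (comp g f) = comp (fmap g) (fmap f) }.

Arguments fmap {C D} _ [X Y] _.

Program Definition id_functor (C : category) : functor C C :=
  @Functor C C (fun X => X) (fun X Y f => f) _ _.
Next Obligation. by []. Qed.
Next Obligation. by []. Qed.

Program Definition comp_functor (C D E : category)
    (G : functor D E) (F : functor C D) : functor C E :=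
  @Functor C E (fun X => G (F X)) (fun X Y f => fmap G (fmap F f)) _ _.
Next Obligation. by move=> C D E G F X /=; rewrite !fmap1. Qed.
Next Obligation. by move=> C D E G F X Y Z g f /=; rewrite !fmapM. Qed.

(* Isomorphism, not equivalence: the composites equal the identity functors on
   the nose. *)
Definition isomorphic_categories (C D : category) : Prop :=
  exists (F : functor C D) (G : functor D C),
    comp_functor G F = id_functor C /\ comp_functor F G = id_functor D.

Program Definition full_subcategory (C : category) (P : C -> Prop) : category :=
  @Category {X : C | P X} (fun X Y => hom (sval X) (sval Y))
    (fun X => idm (sval X)) (fun X Y Z g f => comp g f) _ _ _.
Next Obligation. by move=> C P X Y f /=; rewrite comp1m. Qed.
Next Obligation. by move=> C P X Y f /=; rewrite compm1. Qed.
Next Obligation. by move=> C P X Y Z W f g h /=; rewrite compmA. Qed.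

Record comonad (C : category) := Comonad {
  cofunctor :> functor C C;
  counit : forall X, hom (cofunctor X) X;
  comult : forall X, hom (cofunctor X) (cofunctor (cofunctor X));
  counit_nat : forall X Y (f : hom X Y),
    comp (counit Y) (fmap cofunctor f) = comp f (counit X);
  comult_nat : forall X Y (f : hom X Y),
    comp (comult Y) (fmap cofunctor f) =
    comp (fmap cofunctor (fmap cofunctor f)) (comult X);
  counit_comult : forall X, comp (counit (cofunctor X)) (comult X) = idm _;
  fmap_counit_comult : forall X,
    comp (fmap cofunctor (counit X)) (comult X) = idm _;
  comultA : forall X,
    comp (comult (cofunctor X)) (comult X) =
    comp (fmap cofunctor (comult X)) (comult X) }.

Arguments counit {C} c X.
Arguments comult {C} c X.

Record coalgebra (C : category) (G : comonad C) := Coalgebra {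
  coalg_ob :> C;
  coalg_map : hom coalg_ob (G coalg_ob);
  coalg_comult : comp (comult G coalg_ob) coalg_map =
                 comp (fmap G coalg_map) coalg_map;
  coalg_counit : comp (counit G coalg_ob) coalg_map = idm coalg_ob }.

Arguments coalg_map {C G} c.

Definition coalg_hom (C : category) (G : comonad C) (A B : coalgebra G) :=
  {h : hom A B | comp (coalg_map B) h = comp (fmap G h) (coalg_map A)}.

Lemma coalg_hom_eq (C : category) (G : comonad C) (A B : coalgebra G)
  (f g : coalg_hom A B) : sval f = sval g -> f = g.
Proof. by move: f g => [f ?] [g ?] /= fg; apply: eq_exist. Qed.

Program Definition eilenberg_moore (C : category) (G : comonad C) : category :=
  @Category (coalgebra G) (@coalg_hom C G)
    (fun A => exist _ (idm (coalg_ob A)) _)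
    (fun X Y Z g f => exist _ (comp (sval g) (sval f)) _) _ _ _.
Next Obligation. by move=> C G A /=; rewrite fmap1 comp1m compm1. Qed.
Next Obligation.
move=> C G X Y Z [g gE] [f fE] /=.
by rewrite compmA gE -compmA fE compmA -fmapM.
Qed.
Next Obligation. by move=> *; apply: coalg_hom_eq; rewrite /= comp1m. Qed.
Next Obligation. by move=> *; apply: coalg_hom_eq; rewrite /= compm1. Qed.
Next Obligation. by move=> *; apply: coalg_hom_eq; rewrite /= compmA. Qed.

Record signature := Signature { sym : finType; ar : sym -> nat }.

Record structure (sigma : signature) := Structure {
  carrier :> Type;
  rel_of : forall R : sym sigma, (ar R).-tuple carrier -> Prop }.

Arguments rel_of {sigma} s R _.

Definition is_homomorphism sigma (A B : structure sigma) (f : A -> B) : Prop :=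
  forall (R : sym sigma) (t : (ar R).-tuple A),
    rel_of A R t -> rel_of B R (map_tuple f t).

Definition homomorphism sigma (A B : structure sigma) :=
  {f : A -> B | is_homomorphism f}.

Lemma homomorphism_eq sigma (A B : structure sigma) (f g : homomorphism A B) :
  sval f =1 sval g -> f = g.
Proof. by move: f g => [f ?] [g ?] /= /funext fg; apply: eq_exist. Qed.

Lemma is_homomorphism_id sigma (A : structure sigma) :
  is_homomorphism (fun x : A => x).
Proof.
move=> R t tR; suff -> : map_tuple (fun x : A => x) t = t by [].
by apply: eq_from_tnth => i; rewrite tnth_map.
Qed.

Lemma is_homomorphism_comp sigma (A B D : structure sigma)
    (g : B -> D) (f : A -> B) :
  is_homomorphism g -> is_homomorphism f -> is_homomorphism (fun x => g (f x)).
Proof.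
move=> gH fH R t /fH /gH; congr (rel_of D R _).
by apply: eq_from_tnth => i; rewrite !tnth_map.
Qed.

Program Definition Struct (sigma : signature) : category :=
  @Category (structure sigma) (@homomorphism sigma)
    (fun A => exist _ _ (@is_homomorphism_id sigma A))
    (fun A B D g f =>
       exist _ _ (is_homomorphism_comp (svalP g) (svalP f))) _ _ _.
Next Obligation. by move=> *; apply: homomorphism_eq. Qed.
Next Obligation. by move=> *; apply: homomorphism_eq. Qed.
Next Obligation. by move=> *; apply: homomorphism_eq. Qed.

(* Non-empty sequences in head/tail form, so that the last element needs no
   default value. *)
Record neseq (T : Type) := NeSeq { nehead : T; netail : seq T }.

Definition ne_seq T (s : neseq T) : seq T := nehead s :: netail s.

Coercion ne_seq : neseq >-> seq.

Definition ne_last T (s : neseq T) : T := last (nehead s) (netail s).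

Definition ne_map T U (f : T -> U) (s : neseq T) : neseq U :=
  NeSeq (f (nehead s)) (map f (netail s)).

(* The non-empty prefixes of [s], by increasing length. *)
Definition ne_prefixes T (s : neseq T) : neseq (neseq T) :=
  NeSeq (NeSeq (nehead s) [::])
        (mkseq (fun i => NeSeq (nehead s) (take i.+1 (netail s)))
               (size (netail s))).

(* [is_prefix] avoids [prefix], which needs decidable equality. *)
Definition is_prefix T (s t : seq T) : Prop := exists u, t = s ++ u.

Section Pebbling.
Variables (sigma : signature) (n : nat).

Definition moves (A : Type) := neseq ('I_n * A).

Definition pebble_last (A : Type) (s : moves A) : 'I_n := (ne_last s).1.

Definition elem_last (A : Type) (s : moves A) : A := (ne_last s).2.

Definition pebbling_rel (A : structure sigma) (R : sym sigma)
    (t : (ar R).-tuple (moves A)) : Prop :=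
  [/\ forall i j : 'I_(ar R),
        is_prefix (tnth t i) (tnth t j) \/ is_prefix (tnth t j) (tnth t i),
      forall (i j : 'I_(ar R)) (u : seq ('I_n * A)),
        (tnth t j : seq _) = tnth t i ++ u ->
        pebble_last (tnth t i) \notin map fst u
    & rel_of A R (map_tuple (@elem_last A) t)].

Definition pebbling_structure (A : structure sigma) : structure sigma :=
  @Structure sigma (moves A) (@pebbling_rel A).

Definition moves_map (A B : Type) (f : A -> B) : moves A -> moves B :=
  ne_map (fun m => (m.1, f m.2)).

(* The pebble index of the i-th move is that of the last move of the i-th
   prefix. *)
Definition moves_comult (A : Type) (s : moves A) : moves (moves A) :=
  ne_map (fun t => (pebble_last t, t)) (ne_prefixes s).

Lemma ne_seq_inj T (s t : neseq T) : s = t :> seq T -> s = t.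
Proof. by case: s t => [x s] [y t] [-> ->]. Qed.

Lemma ne_map_comp T U V (g : U -> V) (f : T -> U) (s : neseq T) :
  ne_map g (ne_map f s) = ne_map (fun x => g (f x)) s.
Proof. by rewrite /ne_map /= -map_comp. Qed.

Lemma eq_ne_map T U (f g : T -> U) (s : neseq T) :
  f =1 g -> ne_map f s = ne_map g s.
Proof. by move=> fg; rewrite /ne_map fg (eq_map fg). Qed.

Lemma ne_map_id T (f : T -> T) (s : neseq T) : f =1 id -> ne_map f s = s.
Proof.
by move=> fE; rewrite (eq_ne_map _ fE) /ne_map map_id; case: s.
Qed.

Lemma ne_last_map T U (f : T -> U) (s : neseq T) :
  ne_last (ne_map f s) = f (ne_last s).
Proof. by rewrite /ne_last /= last_map. Qed.

Lemma ne_last_prefixes T (s : neseq T) : ne_last (ne_prefixes s) = s.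
Proof.
case: s => x s; rewrite /ne_last /ne_prefixes /= (last_nth (NeSeq x [::])).
rewrite size_mkseq; case: s => [//|y s] /=.
by rewrite (nth_map 0) ?size_iota // nth_iota //= take_size.
Qed.

Lemma ne_map_last_prefixes T (s : neseq T) :
  ne_map (@ne_last T) (ne_prefixes s) = s.
Proof.
case: s => x s; congr NeSeq; apply: (@eq_from_nth _ x) => /=.
  by rewrite size_map size_mkseq.
move=> i; rewrite size_map size_mkseq => ltis.
rewrite (nth_map (NeSeq x [::])) ?size_mkseq // nth_mkseq // /ne_last /=.
by rewrite (take_nth x) // last_rcons.
Qed.

Lemma ne_prefixes_map T U (f : T -> U) (s : neseq T) :
  ne_prefixes (ne_map f s) = ne_map (ne_map f) (ne_prefixes s).
Proof.
rewrite /ne_prefixes /ne_map /= size_map; congr NeSeq.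
by rewrite /mkseq -map_comp; apply: eq_map => i /=; rewrite map_take.
Qed.

Lemma ne_prefixes_prefixes T (s : neseq T) :
  ne_prefixes (ne_prefixes s) = ne_map (@ne_prefixes T) (ne_prefixes s).
Proof.
case: s => x s; rewrite /ne_prefixes /ne_map /= size_mkseq; congr NeSeq.
rewrite /mkseq -map_comp; apply/eq_in_map => i; rewrite mem_iota add0n => ltis.
congr NeSeq => /=; rewrite -map_take take_iota size_take_min.
rewrite (minn_idPl ltis); apply/eq_in_map => j; rewrite mem_iota /= add0n => ltj.
by rewrite take_takel.
Qed.

Lemma ne_prefixes_cat T (s t : neseq T) :
  is_prefix s t -> is_prefix (ne_prefixes s) (ne_prefixes t).
Proof.
case: s t => [x s] [y t] [u] /= [-> ->].
rewrite /ne_prefixes /ne_seq /= size_cat /mkseq iotaD map_cat add0n.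
eexists; congr (_ :: (_ ++ _)); apply/eq_in_map => i.
rewrite mem_iota add0n => /= ltis; congr NeSeq.
by rewrite takel_cat.
Qed.

Lemma moves_map_pebbles (A B : Type) (f : A -> B) (s : seq ('I_n * A)) :
  map fst (map (fun m => (m.1, f m.2)) s) = map fst s.
Proof. by rewrite -map_comp. Qed.

Lemma pebble_last_map (A B : Type) (f : A -> B) (s : moves A) :
  pebble_last (moves_map f s) = pebble_last s.
Proof. by rewrite /pebble_last ne_last_map. Qed.

Lemma elem_last_map (A B : Type) (f : A -> B) (s : moves A) :
  elem_last (moves_map f s) = f (elem_last s).
Proof. by rewrite /elem_last ne_last_map. Qed.

Lemma pebble_last_comult (A : Type) (s : moves A) :
  pebble_last (moves_comult s) = pebble_last s.
Proof.
by rewrite /moves_comult {1}/pebble_last ne_last_map ne_last_prefixes.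
Qed.

Lemma elem_last_comult (A : Type) (s : moves A) :
  elem_last (moves_comult s) = s.
Proof. by rewrite /elem_last ne_last_map ne_last_prefixes. Qed.

Lemma moves_map_last_comult (A : Type) (s : moves A) :
  moves_map (@elem_last A) (moves_comult s) = s.
Proof.
rewrite /moves_map ne_map_comp /= -[RHS]ne_map_last_prefixes.
by apply: eq_ne_map => t; rewrite /pebble_last /elem_last -surjective_pairing.
Qed.

Lemma moves_comult_nat (A B : Type) (f : A -> B) (s : moves A) :
  moves_comult (moves_map f s) = moves_map (moves_map f) (moves_comult s).
Proof.
rewrite /moves_comult /moves_map ne_prefixes_map !ne_map_comp.
by apply: eq_ne_map => t /=; rewrite (pebble_last_map f t).
Qed.

Lemma moves_comultA (A : Type) (s : moves A) :
  moves_comult (moves_comult s) = moves_map (@moves_comult A) (moves_comult s).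
Proof.
rewrite {1 2}/moves_comult ne_prefixes_map ne_prefixes_prefixes.
rewrite /moves_map /moves_comult !ne_map_comp; apply: eq_ne_map => t /=.
by rewrite (pebble_last_comult t).
Qed.

Lemma moves_map_prefix (A B : Type) (f : A -> B) (s t : moves A) :
  is_prefix s t -> is_prefix (moves_map f s) (moves_map f t).
Proof.
case=> u tE; exists (map (fun m => (m.1, f m.2)) u).
have mE (r : moves A) :
  moves_map f r = map (fun m => (m.1, f m.2)) r :> seq _ by [].
by rewrite !mE tE map_cat.
Qed.

Lemma moves_comult_prefix (A : Type) (s t : moves A) :
  is_prefix s t -> is_prefix (moves_comult s) (moves_comult t).
Proof.
move=> /ne_prefixes_cat[u tE].
exists (map (fun t => (pebble_last t, t)) u).
have mE (r : moves A) : moves_comult r =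
  map (fun t => (pebble_last t, t)) (ne_prefixes r) :> seq _ by [].
by rewrite !mE tE map_cat.
Qed.

Lemma is_homomorphism_elem_last (A : structure sigma) :
  @is_homomorphism sigma (pebbling_structure A) A (@elem_last A).
Proof. by move=> R t []. Qed.

Lemma is_homomorphism_moves_map (A B : structure sigma) (f : A -> B) :
  is_homomorphism f ->
  @is_homomorphism sigma (pebbling_structure A) (pebbling_structure B)
    (moves_map f).
Proof.
move=> fH R t [cmp peb relt]; split.
- by move=> i j; rewrite !tnth_map;
     case: (cmp i j) => ?; [left|right]; exact: moves_map_prefix.
- move=> i j u; rewrite !tnth_map => tE; rewrite pebble_last_map.
  pose g (m : 'I_n * A) := (m.1, f m.2).
  have mE (r : moves A) : moves_map f r = map g r :> seq _ by [].
  have [v vE] : is_prefix (tnth t i) (tnth t j).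
    case: (cmp i j) => // -[w wE]; have := congr1 size tE.
    rewrite !mE wE !(size_map, size_cat) => /eqP.
    rewrite -[X in X == _]addn0 -!addnA eqn_add2l eq_sym addn_eq0.
    by case: w wE => //; rewrite cats0 => wE _; exists [::]; rewrite cats0; apply: esym.
  have := tE; rewrite !mE vE map_cat.
  move=> /(congr1 (drop (size (map g (tnth t i))))).
  rewrite !drop_size_cat // => <-; rewrite moves_map_pebbles.
  exact: peb vE.
- have := fH _ _ relt; congr (rel_of B R _).
  by apply: eq_from_tnth => i; rewrite !tnth_map elem_last_map.
Qed.

Lemma is_homomorphism_moves_comult (A : structure sigma) :
  @is_homomorphism sigma (pebbling_structure A)
    (pebbling_structure (pebbling_structure A)) (@moves_comult A).
Proof.
move=> R t tR; have [cmp peb relt] := tR; split.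
- by move=> i j; rewrite !tnth_map;
     case: (cmp i j) => ?; [left|right]; exact: moves_comult_prefix.
- move=> i j u; rewrite !tnth_map => tE; rewrite pebble_last_comult.
  pose g (m : 'I_n * moves A) := (m.1, elem_last m.2).
  have mE (r : moves A) : r = map g (moves_comult r) :> seq _.
    by rewrite -[in LHS](moves_map_last_comult r).
  rewrite -(moves_map_pebbles (@elem_last A) u).
  by apply: (peb i j); rewrite [LHS]mE tE map_cat -mE.
- suff -> : map_tuple (@elem_last (moves A)) (map_tuple (@moves_comult A) t) = t
    by [].
  by apply: eq_from_tnth => i; rewrite !tnth_map elem_last_comult.
Qed.

Program Definition pebbling_functor : functor (Struct sigma) (Struct sigma) :=
  @Functor (Struct sigma) (Struct sigma) pebbling_structure
    (fun A B f => exist _ _ (is_homomorphism_moves_map (svalP f))) _ _.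
Next Obligation.
by move=> A; apply: homomorphism_eq => s; apply: ne_map_id => -[].
Qed.
Next Obligation.
by move=> A B D g f; apply: homomorphism_eq => s /=; rewrite /moves_map ne_map_comp.
Qed.

Program Definition pebbling_comonad : comonad (Struct sigma) :=
  @Comonad (Struct sigma) pebbling_functor
    (fun A => exist _ _ (@is_homomorphism_elem_last A))
    (fun A => exist _ _ (@is_homomorphism_moves_comult A)) _ _ _ _ _.
Next Obligation.
by move=> A B f; apply: homomorphism_eq => s; apply: elem_last_map.
Qed.
Next Obligation.
by move=> A B f; apply: homomorphism_eq => s; apply: moves_comult_nat.
Qed.
Next Obligation.
by move=> A; apply: homomorphism_eq => s; apply: elem_last_comult.
Qed.
Next Obligation.
by move=> A; apply: homomorphism_eq => s; apply: moves_map_last_comult.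
Qed.
Next Obligation.
by move=> A; apply: homomorphism_eq => s; apply: moves_comultA.
Qed.

End Pebbling.

Section Forests.
Local Open Scope card_scope.
Local Open Scope classical_set_scope.

Definition down_set (T : Type) (le : T -> T -> Prop) (x : T) : set T :=
  [set y | le y x].

Definition is_forest (T : Type) (le : T -> T -> Prop) : Prop :=
  [/\ Relation_Definitions.order T le,
      forall x, finite_set (down_set le x)
    & forall x y z, down_set le x y -> down_set le x z -> le y z \/ le z y].

(* The number k such that the down-set of x has k + 1 elements (0 by default,
   which does not occur in a forest). *)
Definition height (T : Type) (le : T -> T -> Prop) (x : T) : nat :=
  xget 0 [set k | down_set le x #= `I_k.+1].

Definition is_forest_morphism (T U : Type) (leT : T -> T -> Prop)
    (leU : U -> U -> Prop) (f : T -> U) : Prop :=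
  (forall x y, leT x y -> leU (f x) (f y)) /\
  (forall x, height leU (f x) = height leT x).

End Forests.

Section PebbleForests.
Variables (sigma : signature) (n : nat).

Record pebble_forest := PebbleForest {
  pf_str :> structure sigma;
  pf_le : pf_str -> pf_str -> Prop;
  pf_forest : is_forest pf_le;
  pf_pebble : pf_str -> 'I_n }.

Definition pebble_forest_hom (A B : pebble_forest) :=
  {f : homomorphism A B |
    is_forest_morphism (@pf_le A) (@pf_le B) (sval f) /\
    forall x, pf_pebble (sval f x) = pf_pebble x}.

Lemma pebble_forest_hom_eq (A B : pebble_forest) (f g : pebble_forest_hom A B) :
  sval f = sval g -> f = g.
Proof. by move: f g => [f ?] [g ?] /= fg; apply: eq_exist. Qed.

Program Definition pebble_forests : category :=
  @Category pebble_forest pebble_forest_hom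
    (fun A => exist _ (@idm (Struct sigma) (pf_str A)) _)
    (fun A B D g f => exist _ (@comp (Struct sigma) _ _ _ (sval g) (sval f)) _)
    _ _ _.
Next Obligation. by []. Qed.
Next Obligation.
move=> A B D [g [[gm gh] gp]] [f [[fm fh] fp]] /=; split=> [|x].
  by split=> [x y /fm /gm //|x]; rewrite gh fh.
by rewrite gp fp.
Qed.
Next Obligation.
by move=> *; apply: pebble_forest_hom_eq; apply: homomorphism_eq.
Qed.
Next Obligation.
by move=> *; apply: pebble_forest_hom_eq; apply: homomorphism_eq.
Qed.
Next Obligation.
by move=> *; apply: pebble_forest_hom_eq; apply: homomorphism_eq.
Qed.

Definition gaifman_adj (A : structure sigma) (a b : A) : Prop :=
  a <> b /\ exists (R : sym sigma) (t : (ar R).-tuple A),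
    rel_of A R t /\ (exists i, tnth t i = a) /\ (exists j, tnth t j = b).

Definition condE (A : pebble_forest) : Prop :=
  forall a b : A, gaifman_adj a b -> pf_le a b \/ pf_le b a.

Definition pf_lt (A : pebble_forest) (a b : A) : Prop := pf_le a b /\ a <> b.

Definition condP (A : pebble_forest) : Prop :=
  forall a b : A, gaifman_adj a b -> pf_lt a b ->
    forall x : A, pf_lt a x -> pf_le x b -> pf_pebble a <> pf_pebble x.

End PebbleForests.

(* Main.v *)
(* A coalgebra alpha : A -> P_n A lists, for each x, the chain of elements up to
   x with their pebbles: the comultiplication law says that the i-th prefix of
   alpha x is alpha of its i-th element. So "alpha x is a prefix of alpha y" is
   a forest order, the branches of this order recover alpha, and alpha is a
   homomorphism exactly when (E) and (P) hold. A monotone height-preserving map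
   sends branches to branches, so the functor from coalgebras to forests is
   fully faithful; it is moreover bijective on objects. *)
Require Import Defs.
From mathcomp Require Import all_boot.
From mathcomp Require Import boolp classical_sets cardinality.
(* Restores [comp] for categories, shadowed by that of ssrfun. *)
Import Defs.

Set Implicit Arguments.
Unset Strict Implicit.
Unset Printing Implicit Defensive.

(** * Equality of functors and isomorphism of categories *)

Definition eqhom (C : category) (X Y : C) (e : X = Y) : hom X Y :=
  match e with erefl => idm X end.

Lemma fmap_eqhom (C D : category) (F : functor C D) (X Y : C) (e : X = Y) :
  fmap F (eqhom e) = eqhom (congr1 F e).
Proof. by case: _ / e; exact: fmap1. Qed.

Lemma eqhomK (C : category) (X Y : C) (e : X = Y) :
  comp (eqhom (esym e)) (eqhom e) = idm X.
Proof. by case: _ / e; exact: comp1m. Qed.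

Lemma eqhomVK (C : category) (X Y : C) (e : X = Y) :
  comp (eqhom e) (eqhom (esym e)) = idm Y.
Proof. by case: _ / e; exact: comp1m. Qed.

(** [fmap F f] and [fmap G f] live in different types, so they are compared through [eqhom]. Once
    the object maps are identified, proof irrelevance turns each [eqhom] into an identity. *)
Lemma functor_eq (C D : category) (F G : functor C D)
    (FG : forall X, F X = G X) :
  (forall X Y (f : hom X Y),
     comp (eqhom (FG Y)) (fmap F f) = comp (fmap G f) (eqhom (FG X))) ->
  F = G.
Proof.
case: F G FG => [F Ff F1 FM] [G Gf G1 GM] /= FG.
have E : F = G by apply: funext.
case: _ / E in Gf G1 GM FG * => fE.
have E : Ff = Gf.
  apply: functional_extensionality_dep => X.
  apply: functional_extensionality_dep => Y.
  apply/funext => f; have := fE X Y f.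
  by rewrite !(Prop_irrelevance (FG _) erefl) /= comp1m compm1.
case: _ / E in G1 GM fE *.
by rewrite (Prop_irrelevance F1 G1) (Prop_irrelevance FM GM).
Qed.

(** The inverse sends a morphism to the unique preimage under [F] of its conjugate by the equalities
    [F (g X) = X]; faithfulness gives the functor laws and one of the two composites. *)
Lemma fully_faithful_bijective_iso (C D : category) (F : functor C D) :
  bijective F ->
  (forall X Y, injective (@fmap C D F X Y)) ->
  (forall X Y (f : hom (F X) (F Y)), exists g, fmap F g = f) ->
  isomorphic_categories C D.
Proof.
move=> [g FK gK] Finj Fsurj.
pose lift X Y (f : hom X Y) : hom (F (g X)) (F (g Y)) :=
  comp (eqhom (esym (gK Y))) (comp f (eqhom (gK X))).
pose G' X Y (f : hom X Y) := sval (cid (Fsurj _ _ (lift X Y f))).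
have G'E X Y f : fmap F (G' X Y f) = lift X Y f by rewrite /G'; case: cid.
have G1 X : G' X X (idm X) = idm (g X).
  by apply: Finj; rewrite G'E fmap1 /lift comp1m eqhomK.
have GM X Y Z (v : hom Y Z) (u : hom X Y) :
    G' X Z (comp v u) = comp (G' Y Z v) (G' X Y u).
  apply: Finj; rewrite fmapM !G'E /lift -!compmA; congr (comp _ (comp _ _)).
  by rewrite compmA eqhomVK comp1m.
pose G := @Functor D C g G' G1 GM.
exists F, G; split.
  apply: (@functor_eq _ _ (comp_functor G F) (id_functor C) FK) => X Y f /=.
  apply: Finj; rewrite !fmapM G'E !fmap_eqhom /lift.
  rewrite !(Prop_irrelevance (congr1 F (FK _)) (gK (F _))).
  by rewrite compmA eqhomVK comp1m.
apply: (@functor_eq _ _ (comp_functor F G) (id_functor D) gK) => X Y f /=.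
by rewrite G'E /lift compmA eqhomVK comp1m.
Qed.

(** * Prefixes of sequences *)

Lemma ne_lastE T (s : neseq T) d : ne_last s = nth d s (size s).-1.
Proof. by rewrite -last_nth. Qed.

Lemma nth_ne_prefixes T (s : neseq T) d i : i < size s ->
  nth d (ne_prefixes s) i = take i.+1 s :> seq T.
Proof. by case: i => [|i] /= ltis; rewrite ?take0 // nth_mkseq. Qed.

Lemma size_ne_prefixes T (s : neseq T) : size (ne_prefixes s) = size s.
Proof. by rewrite /= size_mkseq. Qed.

Lemma is_prefix_take T (s : seq T) k : is_prefix (take k s) s.
Proof. by exists (drop k s); rewrite cat_take_drop. Qed.

Lemma is_prefixE T (s t : seq T) : is_prefix s t -> s = take (size s) t.
Proof. by case=> u ->; rewrite take_size_cat. Qed.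

Lemma is_prefix_refl T (s : seq T) : is_prefix s s.
Proof. by exists [::]; rewrite cats0. Qed.

Lemma is_prefix_trans T (s t u : seq T) :
  is_prefix s t -> is_prefix t u -> is_prefix s u.
Proof. by move=> [v ->] [w ->]; exists (v ++ w); rewrite catA. Qed.

Lemma is_prefix_anti T (s t : seq T) : is_prefix s t -> is_prefix t s -> s = t.
Proof.
move=> [v ->] [w] /(congr1 size) /eqP; rewrite !size_cat.
rewrite -addnA -[X in X == _]addn0 eqn_add2l eq_sym addn_eq0 => /andP[/nilP -> _].
by rewrite cats0.
Qed.

Lemma is_prefix_total T (s t u : seq T) :
  is_prefix s u -> is_prefix t u -> is_prefix s t \/ is_prefix t s.
Proof.
move=> /is_prefixE -> /is_prefixE ->; case: (leqP (size s) (size t)) => [|/ltnW] le_st.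
  by left; rewrite -(take_takel u le_st); exact: is_prefix_take.
by right; rewrite -(take_takel u le_st); exact: is_prefix_take.
Qed.

(* [b x] is the branch ending in [x], its entries decorating elements of [T].
   With [M = 'I_n * T] and [e = snd] these are the coalgebra laws of the
   pebbling comonad, with [M = T] the entries of [b x] are the chain below [x]. *)
Definition branching (T M : Type) (e : M -> T) (b : T -> neseq M) : Prop :=
  (forall x, e (ne_last (b x)) = x) /\
  (forall x, ne_prefixes (b x) = ne_map (fun m => b (e m)) (b x)).

(** Entrywise form of the second law, in plain sequences: the [i]-th entry stands for an element
    whose own branch is the prefix of length [i.+1]. *)
Lemma nth_branchingP (T M : Type) (e : M -> T) (b : T -> neseq M) :
  (forall x, ne_prefixes (b x) = ne_map (fun m => b (e m)) (b x)) <->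
  (forall x d i, i < size (b x) -> b (e (nth d (b x) i)) = take i.+1 (b x) :> seq M).
Proof.
split=> [bE x d i ltib | bE x].
  rewrite -(nth_ne_prefixes (b (e d))) // bE.
  by rewrite -(nth_map _ (b (e d)) (fun m => b (e m))).
have sE : size (ne_prefixes (b x)) = size (ne_map (fun m => b (e m)) (b x)).
  by rewrite size_ne_prefixes /= size_map.
apply: ne_seq_inj; apply: (@eq_from_nth _ (b x)) => // i.
rewrite size_ne_prefixes => ltib; apply: ne_seq_inj.
have d := nehead (b x).
by rewrite nth_ne_prefixes // -(bE x d i ltib) -(nth_map _ (b x) (fun m => b (e m))).
Qed.

(** * The forest order defined by a branching *)

Section Branching.
Variables (T M : Type) (e : M -> T) (b : T -> neseq M).
Hypothesis bb : branching e b.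

Let le x y := is_prefix (b x) (b y).

Lemma branch_inj x y : b x = b y -> x = y.
Proof. by case: bb => bl _ bxy; rewrite -(bl x) bxy bl. Qed.

Lemma branch_nth x d i : i < size (b x) ->
  b (e (nth d (b x) i)) = take i.+1 (b x) :> seq M.
Proof. by case: bb => _ /nth_branchingP; exact. Qed.

Lemma branch_nth_le x d i : i < size (b x) -> le (e (nth d (b x) i)) x.
Proof. by move=> ltib; rewrite /le branch_nth //; exact: is_prefix_take. Qed.

Lemma branch_leP d x y : le y x <->
  exists2 i, i < size (b x) & e (nth d (b x) i) = y.
Proof.
split=> [yx|[i ltib <-]]; last exact: branch_nth_le.
have yE := is_prefixE yx; case: (bb) => bl _.
have ltib : (size (b y)).-1 < size (b x).
  by case: yx => u /(congr1 size) ->; rewrite size_cat /= ltnS leq_addr.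
(* [y] labels the last entry of its own branch, which is a prefix of [b x]. *)
exists (size (b y)).-1 => //; apply: branch_inj; apply: ne_seq_inj.
by rewrite branch_nth.
Qed.

(** The index is read off from the length [i.+1] of the branch of the entry. *)
Lemma branch_nth_inj x d i j : i < size (b x) -> j < size (b x) ->
  e (nth d (b x) i) = e (nth d (b x) j) -> i = j.
Proof.
move=> ltib ltjb eij; have := branch_nth d ltib.
rewrite eij branch_nth // => /(congr1 size).
by rewrite !size_takel // => -[].
Qed.

Lemma card_branch_down_set x : (down_set le x #= `I_(size (b x)))%card.
Proof.
have d := nehead (b x).
have -> : down_set le x = [set e (nth d (b x) i) | i in `I_(size (b x))]%classic.
  apply/seteqP; split=> y /=; first by move=> /(branch_leP d).
  by move=> ?; apply/(branch_leP d).
apply: inj_card_eq => i j; rewrite !inE; exact: branch_nth_inj.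
Qed.

Lemma branch_forest : is_forest le.
Proof.
split=> [|x|x y z]; last exact: is_prefix_total.
- split=> [x|x y z|x y xy yx]; first exact: is_prefix_refl.
  + exact: is_prefix_trans.
  + by apply: branch_inj; apply: ne_seq_inj; exact: is_prefix_anti.
- by exists (size (b x)); exact: card_branch_down_set.
Qed.

Lemma branch_height x : height le x = size (netail (b x)).
Proof.
rewrite /height; case: xgetP => [k -> /= hk|no_k].
  apply: succn_inj; apply/card_eq_II; apply: card_eq_trans (card_branch_down_set x).
  by rewrite card_eq_sym.
(* The default value of [xget] never occurs, since the down-set has a known finite cardinality. *)
by case: (no_k (size (netail (b x)))); exact: card_branch_down_set.
Qed.

End Branching.

(** The [i]-th entry of [b x] is the last entry of [b y] for some [y] below [x]. Monotonicity and
    equality of lengths make [b' (f y)] the prefix of length [i.+1] of [b' (f x)], so agreement on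
    last entries gives agreement at index [i]. *)
Lemma branch_natural (T U M N : Type) (e : M -> T) (e' : N -> U)
    (b : T -> neseq M) (b' : U -> neseq N) (f : T -> U) (g : M -> N) :
  branching e b -> branching e' b' ->
  (forall x y, is_prefix (b x) (b y) -> is_prefix (b' (f x)) (b' (f y))) ->
  (forall x, size (netail (b' (f x))) = size (netail (b x))) ->
  (forall x, ne_last (b' (f x)) = g (ne_last (b x))) ->
  forall x, b' (f x) = ne_map g (b x).
Proof.
move=> bb bb' fm fs fl x; apply: ne_seq_inj.
have sE y : size (b' (f y)) = size (b y) by rewrite /= fs.
have d := nehead (b x).
have bE : ne_map g (b x) = map g (b x) :> seq N by [].
apply: (@eq_from_nth _ (g d)); first by rewrite sE bE size_map.
rewrite sE => i ltib; rewrite bE (nth_map d) //.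
set y := e (nth d (b x) i).
have yE : b y = take i.+1 (b x) :> seq M by exact: (branch_nth bb).
have sy : size (b y) = i.+1 by rewrite yE size_takel.
have /fm/is_prefixE : is_prefix (b y) (b x) by exact: (branch_nth_le bb).
rewrite sE sy => fyE; move: (fl y).
rewrite (ne_lastE _ (g d)) (ne_lastE _ d) sE sy fyE yE.
by rewrite !nth_take.
Qed.

(** * Branches of a given forest order *)

Section ForestBranches.
Variables (T : choiceType) (le : T -> T -> Prop).
Hypothesis le_forest : is_forest le.

Let leb : rel T := fun x y => `[< le x y >].

Let leb_refl : reflexive leb.
Proof. by move=> x; apply/asboolP; case: le_forest => -[]. Qed.

Let leb_trans : transitive leb.
Proof.
case: le_forest => -[_ tr _] _ _ y x z /asboolP xy /asboolP yz.
by apply/asboolP; exact: tr xy yz.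
Qed.

Let leb_anti : antisymmetric leb.
Proof.
by case: le_forest => -[_ _ anti] _ _ x y /andP[/asboolP xy /asboolP]; exact: anti.
Qed.

(** The order is total only within a down-set, hence sorting relative to that predicate. *)
Lemma sorted_down_set x :
  exists s : seq T, [/\ sorted leb s, uniq s & forall y, (y \in s) = leb y x].
Proof.
case: (le_forest) => _ /(_ x) /finite_seqP[s sE] tot.
have memE y : (y \in sort leb (undup s)) = leb y x.
  rewrite mem_sort mem_undup; apply/idP/asboolP => [ys|yx].
    by have : [set` s]%classic y by []; rewrite -sE.
  by have : down_set le x y by []; rewrite sE.
exists (sort leb (undup s)); split=> //; last by rewrite sort_uniq undup_uniq.
apply: (sort_sorted_in (P := [pred y | leb y x])).
  move=> y z /asboolP yx /asboolP zx; apply/orP.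
  by case: (tot _ _ _ yx zx) => ?; [left|right]; apply/asboolP.
by apply/allP => y ys; rewrite inE -memE mem_sort.
Qed.

(** The branch of [x] is its down-set in increasing order, each element decorated by [c]. *)
Lemma forest_branches_choice (M : Type) (e : M -> T) (c : T -> M) :
  cancel c e ->
  exists b : T -> neseq M,
    [/\ branching e b, forall x, ne_last (b x) = c x
      & forall x y, le x y <-> is_prefix (b x) (b y)].
Proof.
move=> cK; have [s sP] := choice sorted_down_set.
have s_sorted x : sorted leb (s x) by case: (sP x).
have s_uniq x : uniq (s x) by case: (sP x).
have mem_s x y : (y \in s x) = leb y x by case: (sP x).
(* Two sorted duplicate-free lists with the same elements coincide, so it suffices that the elements
   below the [i]-th entry are those of index at most [i]. *)
have s_nth x d i : i < size (s x) -> s (nth d (s x) i) = take i.+1 (s x).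
  move=> ltis; apply: (sorted_eq leb_trans leb_anti) => //.
    exact: take_sorted.
  apply: uniq_perm => //; first exact: take_uniq.
  move=> y; rewrite mem_s; apply/idP/idP => [yi|].
    have ys : y \in s x.
      by rewrite mem_s; apply: leb_trans yi _; rewrite -mem_s mem_nth.
    rewrite in_take // ltnS leqNgt; apply/negP => lti.
    have ltys : index y (s x) < size (s x) by rewrite index_mem.
    have := sorted_leq_nth leb_trans leb_refl d (s_sorted x) i (index y (s x)).
    move=> /(_ ltis ltys (ltnW lti)); rewrite nth_index // => iy.
    (* An index of [y] beyond [i] would put the [i]-th entry below [y] as well, forcing equality. *)
    have yE : y = nth d (s x) i by apply: leb_anti; rewrite yi iy.
    by move: lti; rewrite yE (index_uniq d ltis (s_uniq x)) ltnn.
  move=> yt; have ys := mem_take yt; move: yt; rewrite in_take // ltnS => le_yi.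
  have ltys : index y (s x) < size (s x) by rewrite index_mem.
  have := sorted_leq_nth leb_trans leb_refl d (s_sorted x) (index y (s x)) i.
  by move=> /(_ ltys ltis le_yi); rewrite nth_index.
(* The last entry lies in the down-set of [x], and [x], being listed, lies below it. *)
have s_last x d : last d (s x) = x.
  have xs : x \in s x by rewrite mem_s leb_refl.
  have s_gt0 : 0 < size (s x) by case: (s x) xs.
  have lts : (size (s x)).-1 < size (s x) by rewrite ltn_predL.
  have lt_xs : index x (s x) < size (s x) by rewrite index_mem.
  apply: leb_anti; rewrite -nth_last -mem_s mem_nth //=.
  have := sorted_leq_nth leb_trans leb_refl d (s_sorted x) (index x (s x)) (size (s x)).-1.
  rewrite nth_index // => -> //.
  by rewrite -ltnS prednK.
have [b bE] : exists b : T -> neseq M, forall x, b x = map c (s x) :> seq M.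
  exists (fun x => NeSeq (c (head x (s x))) (map c (behead (s x)))) => x.
  by case: (s x) (s_last x (x : T)) (mem_s x x) => //=; rewrite leb_refl.
have b_last x : ne_last (b x) = c x.
  by rewrite (ne_lastE _ (c x)) bE nth_last last_map s_last.
exists b; split=> [|//|x y].
  split=> [x|]; first by rewrite b_last.
  apply/nth_branchingP => x d i; rewrite bE size_map => ltis.
  by rewrite (nth_map (e d)) // cK bE s_nth // map_take.
split=> [/asboolP xy|[u yE]].
  have xs : x \in s y by rewrite mem_s.
  rewrite !bE -{1}(nth_index x xs) s_nth ?index_mem // map_take.
  exact: is_prefix_take.
have sE z : s z = map e (b z).
  by rewrite bE -map_comp (eq_map (g := id)) ?map_id.
by apply/asboolP; rewrite -/(leb x y) -mem_s !sE yE map_cat mem_cat -sE mem_s leb_refl.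
Qed.

End ForestBranches.

(** * Coalgebra laws as branchings *)

Lemma ne_map_fixed (M N : Type) (f : M -> M) (h : M -> M -> N) (s : neseq M) :
  ne_map f s = s -> ne_map (fun m => h (f m) m) s = ne_map (fun m => h m m) s.
Proof.
case: s => x s; rewrite /ne_map /= => -[-> fs]; congr NeSeq.
by elim: s fs => //= y s IHs [-> /IHs ->].
Qed.

(** Forgetting the outer pebble indices turns the comultiplication law into the branching law.
    Conversely, these indices are forced by the last moves of the prefixes. *)
Lemma branching_comult (n : nat) (A : Type) (alpha : A -> moves n A) :
  branching snd alpha <->
  (forall x, elem_last (alpha x) = x) /\
  (forall x, moves_comult (alpha x) = moves_map alpha (alpha x)).
Proof.
split=> -[lastE prefE]; split=> // x; last first.
  have := congr1 (ne_map snd) (prefE x).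
  by rewrite /moves_comult /moves_map !ne_map_comp /= ne_map_id.
rewrite /moves_comult prefE ne_map_comp /moves_map.
(* Each move [m] of [alpha x] is the last move of [alpha m.2], so both carry the same pebble. *)
have fixE : ne_map (fun m => ne_last (alpha m.2)) (alpha x) = alpha x.
  by rewrite -(ne_map_comp (@ne_last _)) -prefE ne_map_last_prefixes.
exact: (ne_map_fixed (fun m m' => (m.1, alpha m'.2)) fixE).
Qed.

(** * Homomorphisms and the conditions (E) and (P) *)

Section MoveBranchings.
Variables (sigma : signature) (n : nat) (A : structure sigma).
Variable alpha : A -> moves n A.
Hypothesis alphaB : branching snd alpha.

Definition branching_forest : pebble_forest sigma n :=
  PebbleForest (branch_forest alphaB) (fun x => pebble_last (alpha x)).

(** Comparability of the branches of related elements is (E). When [alpha a] is a prefix of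
    [alpha b], the remainder lists the [x] with [a < x <= b], so non-recurrence of the pebble of [a]
    is (P). The condition on last elements holds because [alpha x] ends in [x]. *)
Lemma branching_homomorphismP :
  @is_homomorphism sigma A (pebbling_structure n A) alpha <->
  condE branching_forest /\ condP branching_forest.
Proof.
have [lastE _] := alphaB; split=> [alphaH|[Econd Pcond] R t tR].
  split=> [a b|a b] [_ [R [t [tR [[i ia] [j jb]]]]]].
    have [cmp _ _] := alphaH R t tR.
    by have := cmp i j; rewrite !tnth_map ia jb.
  move=> _ x [[[|m u] xE] a_neq_x] [v bE] /= pE.
    by case: a_neq_x; apply: (branch_inj alphaB); apply: ne_seq_inj; rewrite xE cats0.
  (* The remainder of [alpha b] after [alpha a] is [(m :: u) ++ v], and the last move of [alpha x]
     lies in its first piece. *)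
  have [_ peb _] := alphaH R t tR; have := peb i j ((m :: u) ++ v).
  rewrite !tnth_map ia jb catA -xE => /(_ bE); rewrite pE map_cat mem_cat.
  have -> : pebble_last (alpha x) = (last m u).1.
    by rewrite /pebble_last (ne_lastE _ m) xE nth_last last_cat.
  by rewrite -last_map /= mem_last.
have adj i j : tnth t i <> tnth t j -> gaifman_adj (tnth t i) (tnth t j).
  by move=> tij; split=> //; exists R, t; split=> //; split; [exists i|exists j].
split=> [i j|i j u|].
- rewrite !tnth_map; case: (pselect (tnth t i = tnth t j)) => [->|/adj/Econd //].
  by left; exact: is_prefix_refl.
- rewrite !tnth_map; set a := tnth t i; set b := tnth t j => bE; apply/negP.
  move=> pu; have d := nehead (alpha b).
  have [k ltku pE] : exists2 k, k < size u & (nth d u k).1 = pebble_last (alpha a).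
    elim: u pu {bE} => //= m u IHu; rewrite inE => /orP[/eqP ->|/IHu [k]].
      by exists 0.
    by exists k.+1.
  have a_neq_b : a <> b.
    move=> ab; move: bE ltku; rewrite ab => /(congr1 size)/eqP.
    by rewrite size_cat -[X in X == _]addn0 eqn_add2l => /eqP <-.
  have ab : is_prefix (alpha a) (alpha b) by exists u.
  (* Position in [alpha b] of the offending move of [u]; its element [x] satisfies [a < x <= b] and
     carries the pebble of [a], against (P). *)
  set l := size (alpha a) + k.
  have ltlb : l < size (alpha b) by rewrite bE size_cat ltn_add2l.
  pose x := (nth d (alpha b) l).2.
  have xE : alpha x = take l.+1 (alpha b) :> seq _ by exact: (branch_nth alphaB).
  have sx : size (alpha x) = l.+1 by rewrite xE size_takel.
  have ax : is_prefix (alpha a) (alpha x).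
    rewrite (is_prefixE ab) xE -(take_takel _ (_ : size (alpha a) <= l.+1)).
      exact: is_prefix_take.
    by rewrite leqW // leq_addr.
  apply: (Pcond a b (adj _ _ a_neq_b) (conj ab a_neq_b) x) => /=.
  + split=> // ax'; move: sx; rewrite -ax' /l => /eqP.
    by rewrite -addnS -[X in X == _]addn0 eqn_add2l.
  + by rewrite /= xE; exact: is_prefix_take.
  + rewrite -pE /pebble_last (ne_lastE _ d) sx xE -[l.+1.-1]/l nth_take // bE nth_cat.
    by rewrite /l ltnNge leq_addr addKn.
- suff -> : map_tuple (@elem_last n A) (map_tuple alpha t) = t by [].
  by apply: eq_from_tnth => i; rewrite !tnth_map; exact: lastE.
Qed.

End MoveBranchings.

(** The converse is [branch_natural]: the last move of [beta (f x)] consists of the preserved pebble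
    and the element [f x]. *)
Lemma branching_forest_morphismP (sigma : signature) (n : nat)
    (A B : structure sigma) (alpha : A -> moves n A) (beta : B -> moves n B)
    (alphaB : branching snd alpha) (betaB : branching snd beta) (f : A -> B) :
  (forall x, beta (f x) = moves_map f (alpha x)) <->
  is_forest_morphism (@pf_le _ _ (branching_forest alphaB))
    (@pf_le _ _ (branching_forest betaB)) f /\
  forall x, pebble_last (beta (f x)) = pebble_last (alpha x).
Proof.
split=> [fE|[[fm fh] fp]].
  split=> [|x]; last by rewrite fE pebble_last_map.
  split=> [x y|x] /=; first by rewrite !fE; exact: moves_map_prefix.
  by rewrite (branch_height betaB) (branch_height alphaB) fE /= size_map.
have [alphaL _] := alphaB; have [betaL _] := betaB.
apply: (branch_natural (g := fun m => (m.1, f m.2)) alphaB betaB) => // x.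
  by have := fh x; rewrite (branch_height betaB) (branch_height alphaB).
rewrite alphaL -/(pebble_last (alpha x)) -fp -[X in (_, X)]betaL.
exact: surjective_pairing.
Qed.

(** Each element is decorated with its pebble; [{classic A}] supplies the choice structure needed
    for sorting. *)
Lemma forest_branching (sigma : signature) (n : nat) (A : pebble_forest sigma n) :
  {alpha : A -> moves n A |
    [/\ branching snd alpha, forall x, pebble_last (alpha x) = pf_pebble x
      & forall x y, pf_le x y <-> is_prefix (alpha x) (alpha y)]}.
Proof.
have cK : cancel (fun x : {classic A} => (pf_pebble (x : A), x)) snd by [].
have [alpha aP] := cid
  (@forest_branches_choice {classic A} (@pf_le _ _ A) (pf_forest A) _ _ _ cK).
have [aB aL aLe] := aP; exists (alpha : A -> moves n A).
by split=> // x; rewrite /pebble_last aL.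
Qed.

(** * Equality of objects, up to proof irrelevance *)

Lemma coalgebra_eq (C : category) (G : comonad C) (A : C)
    (f g : hom A (G A)) fM gM f1 g1 :
  f = g -> @Coalgebra C G A f fM f1 = @Coalgebra C G A g gM g1.
Proof.
by move=> fg; case: _ / fg in gM g1 *; congr Coalgebra; exact: Prop_irrelevance.
Qed.

Lemma pebble_forest_eq (sigma : signature) (n : nat) (A : structure sigma)
    (le le' : A -> A -> Prop) leF leF' (p p' : A -> 'I_n) :
  (forall x y, le x y <-> le' x y) -> p =1 p' ->
  @PebbleForest sigma n A le leF p = @PebbleForest sigma n A le' leF' p'.
Proof.
move=> leE /funext ->.
have E : le = le' by apply/funext => x; apply/funext => y; apply/propext.
by case: _ / E in leF' *; congr PebbleForest; exact: Prop_irrelevance.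
Qed.

#[local] Obligation Tactic := idtac.

(** * The functor from coalgebras to forests and its inverse on objects *)

Section Isomorphism.
Variables (sigma : signature) (n : nat).

Local Notation EM := (eilenberg_moore (pebbling_comonad sigma n)).
Local Notation REP := (full_subcategory
  (fun A : pebble_forests sigma n => condE A /\ condP A)).

Definition coalg_fun (A : EM) : carrier (coalg_ob A) -> moves n (carrier (coalg_ob A)) :=
  sval (coalg_map A).

Arguments coalg_fun : clear implicits.

Lemma coalg_branching (A : EM) : branching snd (coalg_fun A).
Proof.
apply/branching_comult; split=> x.
  exact: (congr1 (fun f : homomorphism _ _ => sval f x) (coalg_counit A)).
exact: (congr1 (fun f : homomorphism _ _ => sval f x) (coalg_comult A)).
Qed.

Definition forest_of_coalgebra (A : EM) : REP :=
  exist _ (branching_forest (coalg_branching A))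
    (iffLR (branching_homomorphismP (coalg_branching A)) (svalP (coalg_map A))).

Lemma coalg_homP (A B : EM) (h : homomorphism (coalg_ob A) (coalg_ob B)) :
  comp (coalg_map B) (h : @hom (Struct sigma) _ _) =
  comp (fmap (pebbling_comonad sigma n) (h : @hom (Struct sigma) _ _)) (coalg_map A) <->
  forall x, coalg_fun B (sval h x) = moves_map (sval h) (coalg_fun A x).
Proof.
split=> [hE x|hE]; last exact: homomorphism_eq.
exact: (congr1 (fun f : homomorphism _ _ => sval f x) hE).
Qed.

Lemma coalg_hom_forestP (A B : EM) (h : homomorphism (coalg_ob A) (coalg_ob B)) :
  comp (coalg_map B) (h : @hom (Struct sigma) _ _) =
  comp (fmap (pebbling_comonad sigma n) (h : @hom (Struct sigma) _ _)) (coalg_map A) <->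
  is_forest_morphism (@pf_le _ _ (sval (forest_of_coalgebra A)))
    (@pf_le _ _ (sval (forest_of_coalgebra B))) (sval h) /\
  forall x, pebble_last (coalg_fun B (sval h x)) = pebble_last (coalg_fun A x).
Proof.
apply: iff_trans (coalg_homP h) _.
exact: (branching_forest_morphismP (coalg_branching A) (coalg_branching B)).
Qed.

Program Definition forest_functor : functor EM REP :=
  @Functor EM REP forest_of_coalgebra
    (fun A B h => exist _ (sval h) (iffLR (coalg_hom_forestP _) (svalP h))) _ _.
Next Obligation. by move=> A; exact: eq_exist. Qed.
Next Obligation. by move=> *; exact: eq_exist. Qed.

Definition forest_moves (A : pebble_forest sigma n) : A -> moves n A :=
  sval (forest_branching A).

Lemma forest_moves_branching (A : pebble_forest sigma n) :
  branching snd (@forest_moves A).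
Proof. by rewrite /forest_moves; case: forest_branching => ? []. Qed.

Lemma forest_moves_pebble (A : pebble_forest sigma n) x :
  pebble_last (@forest_moves A x) = pf_pebble x.
Proof. by rewrite /forest_moves; case: forest_branching => ? []. Qed.

Lemma forest_moves_le (A : pebble_forest sigma n) (x y : A) :
  is_prefix (forest_moves x) (forest_moves y) <-> pf_le x y.
Proof.
rewrite /forest_moves; case: forest_branching => ? /= [_ _ leE]; exact: iff_sym.
Qed.

Lemma branching_forest_moves (A : pebble_forest sigma n) :
  branching_forest (@forest_moves_branching A) = A.
Proof.
have := @forest_moves_le A; have := @forest_moves_pebble A.
case: A => A leA fA pA peb le; exact: pebble_forest_eq.
Qed.

(** The criterion speaks of the forest rebuilt from the branches, which equals [A]. *)
Lemma forest_moves_homomorphism (A : pebble_forest sigma n) :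
  condE A /\ condP A ->
  @is_homomorphism sigma A (pebbling_structure n A) (@forest_moves A).
Proof.
move=> AEP; apply/(branching_homomorphismP (@forest_moves_branching A)).
by rewrite branching_forest_moves.
Qed.

Program Definition coalgebra_of_forest (X : REP) : EM :=
  @Coalgebra (Struct sigma) (pebbling_comonad sigma n) (pf_str (sval X))
    (exist _ _ (forest_moves_homomorphism (svalP X))) _ _.
Next Obligation.
move=> X; apply: homomorphism_eq.
by have /branching_comult[] := forest_moves_branching (sval X).
Qed.
Next Obligation.
move=> X; apply: homomorphism_eq.
by have /branching_comult[] := forest_moves_branching (sval X).
Qed.

Lemma coalgebra_of_forestK : cancel coalgebra_of_forest forest_of_coalgebra.
Proof.
(* Both sides become forests of the same branching [forest_moves], differing only in proofs. *)
move=> [A AEP]; apply: eq_exist; rewrite -[RHS]branching_forest_moves.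
exact: pebble_forest_eq.
Qed.

(* The identity is a forest morphism between the rebuilt coalgebra and [A], so
   it commutes with their structure maps, which therefore coincide. *)
Lemma forest_of_coalgebraK : cancel forest_of_coalgebra coalgebra_of_forest.
Proof.
move=> A; pose F : pebble_forest sigma n := sval (forest_of_coalgebra A).
have FB := @forest_moves_branching F.
have /(branching_forest_morphismP FB (coalg_branching A)) idE :
    is_forest_morphism (@pf_le _ _ (branching_forest FB)) (@pf_le _ _ F) id /\
    forall x : F, pebble_last (coalg_fun A x) = pebble_last (forest_moves x).
  split=> [|x]; last by rewrite forest_moves_pebble.
  suff -> : @pf_le _ _ (branching_forest FB) = @pf_le _ _ F by [].
  by apply/funext => x; apply/funext => y; apply/propext; exact: forest_moves_le.
rewrite [RHS](_ : A = Coalgebra (coalg_comult A) (coalg_counit A)); last by case: (A).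
apply: coalgebra_eq; apply: homomorphism_eq => x /=.
by rewrite -[RHS]/(coalg_fun A x) (idE x) /moves_map ne_map_id // => -[].
Qed.

End Isomorphism.

Theorem theorem6p10 (sigma : signature) (n : nat) (n_gt0 : (0 < n)%N) :
  isomorphic_categories
    (eilenberg_moore (pebbling_comonad sigma n))
    (full_subcategory
       (fun A : pebble_forests sigma n => condE A /\ condP A)).
Proof.
apply: (@fully_faithful_bijective_iso _ _ (forest_functor sigma n)).
- by exists (@coalgebra_of_forest sigma n);
    [exact: forest_of_coalgebraK|exact: coalgebra_of_forestK].
(* Morphisms on both sides are homomorphisms satisfying equivalent conditions, hence faithfulness
   here and fullness below. *)
- by move=> A B [f fM] [g gM] /(congr1 sval) fg; exact: eq_exist.
- move=> A B [f fF].
  by exists (exist _ f (iffRL (coalg_hom_forestP f) fF)); exact: eq_exist.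
Qed.
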